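(* There exist nonempty compact convex sets $C_1, C_2, C_3\subseteq \mathbb{R}^3$ such that for every $\varepsilon\in(0,1]$ there is a unique $\varepsilon$-cycle $\mathbf{u}^\varepsilon=(u_1^\varepsilon,u_2^\varepsilon,u_3^\varepsilon)\in(\mathbb{R}^3)^3$ for $C_1,C_2,C_3$, and moreover the limit $\lim_{\varepsilon\downarrow 0}\mathbf{u}^\varepsilon$ does not exist.
   Context: For a nonempty closed convex set $C\subseteq\mathbb{R}^n$, $\Pi_C(u)$ denotes the (unique) Euclidean projection of $u$ onto $C$, i.e. the point of $C$ closest to $u$. Given nonempty closed convex sets $C_1,\dots,C_m$ and a relaxation parameter $\varepsilon\in(0,1]$, an $\varepsilon$-cycle for $C_1,\dots,C_m$ is an $m$-tuple $(u_1,\dots,u_m)$ satisfying $u_1=u_m+\varepsilon(\Pi_{C_1}(u_m)-u_m)$ and $u_i=u_{i-1}+\varepsilon(\Pi_{C_i}(u_{i-1})-u_{i-1})$ for $i=2,\dots,m$. (These are the limit cycles of the under-relaxed cyclic projection method $u_{n+1}=u_n+\varepsilon(\Pi_{C_{i(n)}}(u_n)-u_n)$ cycling through $C_1,\dots,C_m$.) *)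

(* Defs.v *)
From HB Require Import structures.
From mathcomp Require Import all_boot all_order all_algebra.
From mathcomp Require Import all_classical all_reals all_analysis.
From mathcomp Require Import Rstruct Rstruct_topology.
Set Implicit Arguments. Unset Strict Implicit. Unset Printing Implicit Defensive.
Import Order.TTheory GRing.Theory Num.Theory.
Local Open Scope ring_scope.
Local Open Scope classical_set_scope.

Notation R3 := ('rV[Rdefinitions.R]_3).

Definition sqdist (u v : R3) : Rdefinitions.R := \sum_(i < 3) (u ord0 i - v ord0 i) ^+ 2.

Definition convex3 (C : set R3) : Prop :=
  forall x y (t : Rdefinitions.R), C x -> C y -> 0 <= t -> t <= 1 ->
    C (t *: x + (1 - t) *: y).

(* Euclidean projection onto C: the (unique, when C is nonempty closed convex)
   point of C closest to u; chosen by classical choice (default u otherwise). *)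
Definition proj (C : set R3) (u : R3) : R3 :=
  xget u [set p | C p /\ forall q, C q -> sqdist u p <= sqdist u q].

Definition relax (eps : Rdefinitions.R) (C : set R3) (u : R3) : R3 :=
  u + eps *: (proj C u - u).

Definition eps_cycle (eps : Rdefinitions.R) (C1 C2 C3 : set R3)
  (u : R3 * R3 * R3) : Prop :=
  let: (u1, u2, u3) := u in
  [/\ u1 = relax eps C1 u3, u2 = relax eps C2 u1 & u3 = relax eps C3 u2].

(* Main.v *)
From Pilot Require Import Defs.
From HB Require Import structures.
From mathcomp Require Import all_boot all_order all_algebra.
From mathcomp Require Import all_classical all_reals all_analysis.
From mathcomp Require Import Rstruct Rstruct_topology ring lra.
Import Order.TTheory GRing.Theory Num.Theory.
Import numFieldNormedType.Exports.
Local Open Scope ring_scope.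
Local Open Scope classical_set_scope.

(** Let [C1] and [C2] be the vertical segments [|z| <= 1] over the points
    [(2, -1)] and [(2, 1)] of the horizontal plane. They keep heights, so along
    an [eps]-cycle the height is constant, and the cycle equations say that
    [C3] projects the point of the cycle horizontally, onto a point [w] whose
    shadow is the projection of [m = (2, s)], with [s = eps / (2 - eps)], onto
    the shadow of [C3].

    Let [C3] be the closed convex hull of the curve
    [x^2 + y^2 = 1, y > 0, z = sin (x / y)]. Its shadow lies in the unit disc,
    so the shadow of [w] is [m / |m|]; this is an exposed point of the disc,
    and by continuity of [sin (x / y)] the fiber of [C3] over it is the single
    point of the curve. Hence the cycle is unique and its height is
    [sin (2 / s) = sin (4 / eps - 2)], which oscillates as [eps] tends to 0. *)

Local Notation R := Rdefinitions.R.
(* all_analysis shadows the projection of Defs with that of product spaces *)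
Local Notation proj := Pilot.Defs.proj.

(** * Coordinates and the inner product *)

Local Notation cx u := ((u : R3) ord0 ord0).
Local Notation cy u := ((u : R3) ord0 (lift ord0 ord0)).
Local Notation cz u := ((u : R3) ord0 (lift ord0 (lift ord0 ord0))).

Definition pt (x y z : R) : R3 := \row_i [:: x; y; z]`_i.

Lemma ptE x y z : (cx (pt x y z) = x) * (cy (pt x y z) = y) * (cz (pt x y z) = z).
Proof. by rewrite !mxE. Qed.

Lemma R3P (u v : R3) : cx u = cx v -> cy u = cy v -> cz u = cz v -> u = v.
Proof.
move=> ex ey ez; apply/rowP; case=> [[|[|[|//]]] lti].
- by rewrite (_ : Ordinal lti = ord0) //; exact: val_inj.
- by rewrite (_ : Ordinal lti = lift ord0 ord0) //; exact: val_inj.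
- by rewrite (_ : Ordinal lti = lift ord0 (lift ord0 ord0)) //; exact: val_inj.
Qed.

Definition dot (u v : R3) : R := cx u * cx v + cy u * cy v + cz u * cz v.

Lemma sqdistE (u v : R3) : sqdist u v = dot (u - v) (u - v).
Proof. by rewrite /sqdist !big_ord_recl big_ord0 /dot !mxE; ring. Qed.

Lemma dot_ge0 (u : R3) : 0 <= dot u u.
Proof. by rewrite /dot; nra. Qed.

Lemma dot_eq0 (u : R3) : dot u u = 0 -> u = 0.
Proof. by rewrite /dot => h; apply: R3P; rewrite !mxE; nra. Qed.

(** * Continuity and compactness *)

Lemma linear_form_continuous (K : realType) (m : nat) (n : 'rV[K]_m) :
  continuous (fun u : 'rV[K]_m => \sum_i n ord0 i * u ord0 i).
Proof.
move=> u; apply: (@cvg_big K _ +%R _ _ _ _ (nbhs u)) => [|i _].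
  exact: add_continuous.
exact: (@cvgM _ _ (nbhs u) _ (fun=> n ord0 i) _ _ _ (cvg_cst _)
  (@coord_continuous _ _ _ ord0 i u)).
Qed.

Lemma sum_sqr_continuous (K : realType) (m : nat) (n : 'rV[K]_m) :
  continuous (fun u : 'rV[K]_m => \sum_i (n ord0 i - u ord0 i) ^+ 2).
Proof.
move=> u; apply: (@cvg_big K _ +%R _ _ _ _ (nbhs u)) => [|i _].
  exact: add_continuous.
have h : (fun v : 'rV[K]_m => n ord0 i - v ord0 i) @ u --> n ord0 i - u ord0 i.
  exact: (@cvgB _ _ _ (nbhs u) _ (fun=> n ord0 i) _ _ _ (cvg_cst _)
    (@coord_continuous _ _ _ ord0 i u)).
exact: (cvg_comp _ _ h (@exprn_continuous K 2 _)).
Qed.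

Lemma box_compact (K : realType) (m : nat) (c : K) :
  compact [set v : 'rV[K]_m | forall i, `[- c, c] (v ord0 i)].
Proof. by apply: (@rV_compact K m (fun=> `[- c, c])) => i; exact: segment_compact. Qed.

Lemma sin_ratio_cvg (K : realType) (x y : K) : y != 0 ->
  (fun v : K * K => sin (v.1 / v.2)) @ (x, y) --> sin (x / y).
Proof.
move=> y0.
have c1 : (fun v : K * K => v.1) @ (x, y) --> x by exact: cvg_fst.
have c2 : (fun v : K * K => v.2) @ (x, y) --> y by exact: cvg_snd.
have c3 : (fun v : K * K => v.1 / v.2) @ (x, y) --> x / y.
  exact: (@cvgM _ _ (nbhs (x, y)) _ _ _ _ _ c1 (@cvgV _ _ (nbhs (x, y)) _ _ _ y0 c2)).
exact: (cvg_comp _ _ c3 (@continuous_sin K _)).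
Qed.

Lemma dot_continuous (n : R3) : continuous (dot n).
Proof.
rewrite (_ : dot n = fun u => \sum_i n ord0 i * u ord0 i).
  exact: linear_form_continuous.
by apply/funext => u; rewrite !big_ord_recl big_ord0 /dot; ring.
Qed.

Lemma sqdist_continuous (u : R3) : continuous (sqdist u).
Proof. exact: sum_sqr_continuous. Qed.

(** * Projection onto compact convex sets *)

(** The continuous function [sqdist u] attains its minimum on [C], so the choice in [proj] does not
    fall back on its default. *)
Lemma proj_nearest {C : set R3} (u : R3) : compact C -> C !=set0 ->
  C (proj C u) /\ forall q, C q -> sqdist u (proj C u) <= sqdist u q.
Proof.
move=> cC C0.
have [|p /set_mem Cp pmin] := @EVT_min_rV _ _ (sqdist u) C C0 cC.
  exact: continuous_subspaceT (@sqdist_continuous u).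
apply: (@xgetPex R3 u [set p | C p /\ forall q, C q -> sqdist u p <= sqdist u q]).
by exists p; split=> // q Cq; apply: pmin; exact: mem_set.
Qed.

(** A step of length [t] from the projection towards [q] lowers the squared distance by
    [t * (2 * a - t * d)], which for [a > 0] would contradict minimality. *)
Lemma proj_obtuse {C : set R3} (u q : R3) : compact C -> convex3 C -> C q ->
  dot (u - proj C u) (q - proj C u) <= 0.
Proof.
move=> cC vC Cq; have [Cw] := proj_nearest u cC (ex_intro _ q Cq).
move: (proj C u) Cw => w Cw wmin.
have d0 := dot_ge0 (q - w); rewrite leNgt; apply/negP => a0.
set a := dot (u - w) (q - w) in a0; set d := dot (q - w) (q - w) in d0.
(* This choice lies in (0, 1] even if [d = 0], and [t * (a + d) = a] turns [2 * a - t * d] into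
   [a + t * a]. *)
pose t := a / (a + d).
have ad0 : 0 < a + d by lra.
have t0 : 0 < t by rewrite divr_gt0.
have t1 : t <= 1 by rewrite ler_pdivrMr // mul1r; lra.
have := wmin _ (vC _ _ _ Cq Cw (ltW t0) t1).
have -> : sqdist u (t *: q + (1 - t) *: w) = sqdist u w - t * (2 * a - t * d).
  by rewrite !sqdistE /a /d /dot !mxE; ring.
suff : 0 < t * (2 * a - t * d) by lra.
rewrite mulr_gt0 //.
have -> : 2 * a - t * d = a + t * a.
  by rewrite /t; field; rewrite gt_eqF.
by rewrite addr_gt0 // mulr_gt0.
Qed.

(** The obtuse angle at [p] makes every other point of [C] strictly farther from [u], so the choice
    can only return [p]. *)
Lemma proj_eq (C : set R3) (u p : R3) : C p ->
  (forall q, C q -> dot (u - p) (q - p) <= 0) -> proj C u = p.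
Proof.
move=> Cp obt.
have key q : C q -> sqdist u p + dot (q - p) (q - p) <= sqdist u q.
  move=> /obt; have -> : sqdist u q = sqdist u p - 2 * dot (u - p) (q - p)
      + dot (q - p) (q - p) by rewrite !sqdistE /dot !mxE; ring.
  lra.
have [| Cw wmin] := @xgetPex R3 u
  [set p | C p /\ forall q, C q -> sqdist u p <= sqdist u q].
  by exists p; split=> // q /key; have := dot_ge0 (q - p); lra.
apply/eqP; rewrite -subr_eq0; apply/eqP/dot_eq0.
have := dot_ge0 (proj C u - p); have := key _ Cw; have := wmin _ Cp.
by rewrite -/(proj C u); lra.
Qed.

(** * Closed convex hulls *)

(** The closed convex hull in dual form, as an intersection of half-spaces: linear bounds on [K]
    pass to it at once. *)
Definition hull (K : set R3) : set R3 :=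
  [set u | forall (n : R3) (c : R), (forall k, K k -> dot n k <= c) -> dot n u <= c].

Lemma sub_hull (K : set R3) : K `<=` hull K.
Proof. by move=> k Kk n c; exact. Qed.

Lemma hull_convex (K : set R3) : convex3 (hull K).
Proof.
move=> x y t hx hy t0 t1 n c Kc.
have -> : dot n (t *: x + (1 - t) *: y) = t * dot n x + (1 - t) * dot n y.
  by rewrite /dot !mxE; ring.
have := hx _ _ Kc; have := hy _ _ Kc; nra.
Qed.

Lemma hull_closed (K : set R3) : closed (hull K).
Proof.
rewrite (_ : hull K = \bigcap_(nc in [set nc : R3 * R | forall k, K k -> dot nc.1 k <= nc.2])
  [set u | dot nc.1 u <= nc.2]); last first.
  by apply/seteqP; split=> [u hu [n c] /= /hu //|u hu n c Kc]; exact: (hu (n, c)).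
apply: closed_bigI => -[n c] _ /=.
apply: (@closed_comp _ _ (dot n) [set x | x <= c]) (@closed_le _ c) => u _.
exact: dot_continuous.
Qed.

Lemma hull_compact (K : set R3) (c : R) :
  (forall k, K k -> [/\ `|cx k| <= c, `|cy k| <= c & `|cz k| <= c]) -> compact (hull K).
Proof.
move=> Kb.
apply: (@subclosed_compact _ _ [set v : R3 | forall i, `[- c, c] (v ord0 i)]).
- exact: hull_closed.
- exact: box_compact.
move=> u hu.
have bd (n : R3) : (forall k, K k -> `|dot n k| <= c) -> `|dot n u| <= c.
  move=> nK; rewrite ler_norml; apply/andP; split.
    rewrite lerNl.
    have -> : - dot n u = dot (- n) u by rewrite /dot !mxE; ring.
    apply: hu => k /nK; have -> : dot (- n) k = - dot n k by rewrite /dot !mxE; ring.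
    by rewrite ler_norml lerNl => /andP[].
  by apply: hu => k /nK; rewrite ler_norml => /andP[].
have ux : `|cx u| <= c.
  have := bd (pt 1 0 0); rewrite /dot !ptE !mul0r mul1r !addr0; apply=> k /Kb.
  by rewrite !mul0r mul1r !addr0; case.
have uy : `|cy u| <= c.
  have := bd (pt 0 1 0); rewrite /dot !ptE !mul0r mul1r addr0 add0r; apply=> k /Kb.
  by rewrite !mul0r mul1r addr0 add0r; case.
have uz : `|cz u| <= c.
  have := bd (pt 0 0 1); rewrite /dot !ptE !mul0r mul1r !add0r; apply=> k /Kb.
  by rewrite !mul0r mul1r !add0r; case.
case=> [[|[|[|//]]] lti]; rewrite /= in_itv /= -ler_norml.
- by rewrite (_ : Ordinal lti = ord0) //; exact: val_inj.
- by rewrite (_ : Ordinal lti = lift ord0 ord0) //; exact: val_inj.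
- by rewrite (_ : Ordinal lti = lift ord0 (lift ord0 ord0)) //; exact: val_inj.
Qed.

(** * The segments, the curve and its hull *)

Definition segment (b : R) : set R3 :=
  [set u | [/\ cx u = 2, cy u = b & `|cz u| <= 1]].

Definition wave : set R3 :=
  [set u | [/\ cx u ^+ 2 + cy u ^+ 2 = 1, 0 < cy u & cz u = sin (cx u / cy u)]].

(** Bounds on the coordinates and their negatives cut out the segment. Its convexity and compactness
    then follow from those of hulls. *)
Lemma hull_segment (b : R) : hull (segment b) = segment b.
Proof.
apply/seteqP; split=> [u hu|]; last exact: sub_hull.
have le x y z c : (forall k, segment b k -> x * cx k + y * cy k + z * cz k <= c) ->
    x * cx u + y * cy u + z * cz u <= c.
  by move=> hc; have := hu (pt x y z) c; rewrite /dot !ptE; apply.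
split.
- have h1 : 1 * cx u + 0 * cy u + 0 * cz u <= 2 by apply: le => k [-> _ _]; lra.
  have h2 : -1 * cx u + 0 * cy u + 0 * cz u <= -2 by apply: le => k [-> _ _]; lra.
  lra.
- have h1 : 0 * cx u + 1 * cy u + 0 * cz u <= b by apply: le => k [_ -> _]; lra.
  have h2 : 0 * cx u + -1 * cy u + 0 * cz u <= - b by apply: le => k [_ -> _]; lra.
  lra.
- have h1 : 0 * cx u + 0 * cy u + 1 * cz u <= 1.
    by apply: le => k [_ _]; rewrite ler_norml => /andP[]; lra.
  have h2 : 0 * cx u + 0 * cy u + -1 * cz u <= 1.
    by apply: le => k [_ _]; rewrite ler_norml => /andP[]; lra.
  by rewrite ler_norml; lra.
Qed.

Lemma compact_segment (b : R) : `|b| <= 2 -> compact (segment b).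
Proof.
move=> b2; rewrite -hull_segment; apply: (@hull_compact _ 2) => k [-> -> z1].
by split=> //; [rewrite ger0_norm|lra].
Qed.

(** The displacement to this point is horizontal, hence orthogonal to the segment. *)
Lemma proj_segment (b : R) (u : R3) : `|cz u| <= 1 -> proj (segment b) u = pt 2 b (cz u).
Proof.
move=> u1; apply: proj_eq; first by split; rewrite ptE.
by move=> q [qx qy _]; rewrite /dot !mxE /= qx qy; lra.
Qed.

Lemma compact_hull_wave : compact (hull wave).
Proof.
apply: (@hull_compact _ 1) => k [k1 ky kz].
split; [rewrite ler_norml; nra|rewrite ler_norml; nra|rewrite kz; exact: sin_max].
Qed.

(** Each tangent half-plane of the unit disc contains the shadow of the curve, hence that of its
    hull. *)
Lemma hull_wave_disc (u : R3) (p q : R) : hull wave u -> p ^+ 2 + q ^+ 2 = 1 ->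
  p * cx u + q * cy u <= 1.
Proof.
move=> hu pq; have := hu (pt p q 0) 1; rewrite /dot !ptE mul0r addr0; apply=> k [k1 _ _].
by rewrite mul0r addr0; have := sqr_ge0 (p - cx k); have := sqr_ge0 (q - cy k); lra.
Qed.

Lemma hull_wave_height (u : R3) : hull wave u -> `|cz u| <= 1.
Proof.
move=> hu; have le z : `|z| <= 1 -> z * cz u <= 1.
  move=> z1; have := hu (pt 0 0 z) 1; rewrite /dot !ptE !mul0r !add0r; apply=> k [_ _ ->].
  rewrite !mul0r !add0r; apply: le_trans (ler_norm _) _.
  by rewrite normrM mulr_ile1 // sin_max.
have := le 1; have := le (-1); rewrite normrN normr1 => /(_ (lexx _)) + /(_ (lexx _)).
by rewrite ler_norml; lra.
Qed.

(* The last factor is the distance from [l] to the vertical plane tangent to the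
   cylinder at [k], so this bounds the curve by non-vertical affine functions. *)
Lemma wave_height_gap {k : R3} {d : R} : wave k -> 0 < d ->
  exists M : R, forall l, wave l ->
    `|cz l - cz k| <= d + M * (1 - (cx k * cx l + cy k * cy l)).
Proof.
move=> [k1 ky kz] d0.
have /cvgrPdist_le/(_ _ d0) := @sin_ratio_cvg R (cx k) (cy k) (lt0r_neq0 ky).
(* Within [r] of [k] continuity gives the bound [d]. Farther away the tangent distance, half the
   squared chord, is at least [r ^+ 2 / 2], so the [M] term alone reaches 2, the largest possible
   height difference. *)
move=> /nbhs_ballP[r /= r0 near_k]; exists (4 / r ^+ 2) => l [l1 ly lz].
have gapE : 1 - (cx k * cx l + cy k * cy l) =
    ((cx k - cx l) ^+ 2 + (cy k - cy l) ^+ 2) / 2 by move: k1 l1; lra.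
have far_le : r ^+ 2 <= (cx k - cx l) ^+ 2 + (cy k - cy l) ^+ 2 ->
    `|cz l - cz k| <= d + 4 / r ^+ 2 * (1 - (cx k * cx l + cy k * cy l)).
  move=> far; have : `|cz l - cz k| <= 2.
    rewrite kz lz; apply: le_trans (ler_normB _ _) _.
    by have := sin_max (cx l / cy l); have := sin_max (cx k / cy k); lra.
  have : 2 <= 4 / r ^+ 2 * (1 - (cx k * cx l + cy k * cy l)).
    rewrite gapE mulrAC ler_pdivlMr ?exprn_gt0 //; lra.
  lra.
have [xr|xr] := ltP `|cx k - cx l| r; last first.
  apply: far_le; have := sqr_ge0 (cy k - cy l).
  by rewrite -(real_normK (num_real (cx k - cx l))); nra.
have [yr|yr] := ltP `|cy k - cy l| r; last first.
  apply: far_le; have := sqr_ge0 (cx k - cx l).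
  by rewrite -(real_normK (num_real (cy k - cy l))); nra.
have := near_k (cx l, cy l) (conj xr yr); rewrite /= -kz -lz distrC => /le_trans; apply.
rewrite lerDl gapE mulr_ge0 //; first by rewrite divr_ge0 // sqr_ge0.
by rewrite divr_ge0 // addr_ge0 // sqr_ge0.
Qed.

(** The affine bounds of [wave_height_gap], above and below, pass to the hull; over the shadow of
    [k] their [M] term vanishes, leaving a height error of at most [d] for every [d > 0]. *)
Lemma hull_wave_fiber (u k : R3) : hull wave u -> wave k ->
  cx u = cx k -> cy u = cy k -> u = k.
Proof.
move=> hu ak ex ey; have [k1 _ _] := ak.
apply: R3P => //; apply/eqP; rewrite eq_le; apply/andP; split; apply/ler_addgt0Pr => d d0.
  have [M hM] := wave_height_gap ak d0.
  have := hu (pt (M * cx k) (M * cy k) 1) (cz k + d + M).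
  rewrite /dot !ptE ex ey => H.
  suff : M * cx k * cx k + M * cy k * cy k + 1 * cz u <= cz k + d + M.
    have -> : M * cx k * cx k + M * cy k * cy k = M by rewrite -[RHS]mulr1 -k1; ring.
    by lra.
  by apply: H => l /hM; rewrite ler_norml => /andP[_]; lra.
have [M hM] := wave_height_gap ak d0.
have := hu (pt (M * cx k) (M * cy k) (-1)) (- cz k + d + M).
rewrite /dot !ptE ex ey => H.
suff : M * cx k * cx k + M * cy k * cy k + -1 * cz u <= - cz k + d + M.
  have -> : M * cx k * cx k + M * cy k * cy k = M by rewrite -[RHS]mulr1 -k1; ring.
  by lra.
by apply: H => l /hM; rewrite ler_norml => /andP[]; lra.
Qed.

(** * Solving the cycle equations *)

(** The solution of the linear system obtained by fixing the three projections as the points of the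
    two segments at the height of [k], and [k] itself. *)
Definition explicit_cycle (eps : R) (k : R3) : R3 * R3 * R3 :=
  let l := 1 - eps in
  let D := 1 + l + l ^+ 2 in
  let u2 := pt ((l ^+ 2 * cx k + 2 * l + 2) / D) ((l ^+ 2 * cy k - l + 1) / D) (cz k) in
  let u3 := l *: u2 + eps *: k in
  (l *: u3 + eps *: pt 2 (-1) (cz k), u2, u3).

(* The hypotheses on [N] say that [m = (2, s)] is [N] times the shadow of [k]. *)
Lemma eps_cycleP (eps N : R) (k : R3) (u : R3 * R3 * R3) :
  0 < eps -> eps <= 1 -> 1 < N -> wave k ->
  N * cx k = 2 -> N * cy k = eps / (2 - eps) ->
  eps_cycle eps (segment (-1)) (segment 1) (hull wave) u <-> u = explicit_cycle eps k.
Proof.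
move=> e0 e1 N1 ak Nx Ny; have hk := sub_hull _ _ ak.
have [k1 _ _] := ak; have kz1 := hull_wave_height _ hk.
set l := 1 - eps; set D := 1 + l + l ^+ 2.
have D0 : 0 < D by rewrite /D /l; nra.
have Ny' : N * cy k * (1 + l) = 1 - l by rewrite Ny /l; field; lra.
have relaxE C v : relax eps C v = l *: v + eps *: proj C v.
  by rewrite /relax /l; apply/rowP => i; rewrite !mxE; ring.
split; last first.
  move=> ->; rewrite /explicit_cycle -/l -/D.
  set u2 := pt _ _ _; set u3 := l *: u2 + eps *: k; set u1 := l *: u3 + _.
  have u3z : cz u3 = cz k by rewrite !mxE /= /l; ring.
  have u1z : cz u1 = cz k.
    rewrite [LHS]mxE [X in X + _]mxE u3z !mxE /= /l; ring.
  have w3 : proj (hull wave) u2 = k.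
    apply: proj_eq => // q hq.
    have disc := hull_wave_disc _ _ _ hq k1.
    (* [u2 - k] is horizontal and a nonnegative multiple of the outward normal of the disc at
       [k]. *)
    have -> : dot (u2 - k) (q - k) = (1 + l) / D * ((N - 1) * (cx k * cx q + cy k * cy q - 1)).
      have ux : cx (u2 - k) = (1 + l) / D * ((N - 1) * cx k).
        rewrite mulrBl mul1r Nx !mxE /= /D; field; exact: lt0r_neq0.
      have uy : cy (u2 - k) = (1 + l) / D * ((N - 1) * cy k).
        have Ny2 : l ^+ 2 * cy k - l + 1 = l ^+ 2 * cy k + N * cy k * (1 + l).
          by rewrite Ny'; ring.
        rewrite !mxE /= Ny2 /D; field; exact: lt0r_neq0.
      have uz : cz (u2 - k) = 0 by rewrite !mxE /= subrr.
      rewrite /dot ux uy uz -k1 !mxE; ring.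
    rewrite mulr_ge0_le0 //; first by rewrite divr_ge0 ?(ltW D0) // /l; lra.
    by rewrite mulr_ge0_le0 //; lra.
  split; rewrite relaxE.
  - by rewrite proj_segment u3z.
  - have epsE : eps = 1 - l by rewrite /l; ring.
    rewrite proj_segment u1z //; apply: R3P; rewrite !mxE /= epsE /D.
    + by field; exact: lt0r_neq0.
    + by field; exact: lt0r_neq0.
    + ring.
  - by rewrite w3.
case: u => -[u1 u2] u3; rewrite /eps_cycle !relaxE.
(* [proj_segment] does not apply until the heights are known to lie in [-1, 1]. *)
have sub b v : `|b| <= 2 -> segment b (proj (segment b) v).
  move=> b2; apply: (proj_nearest _ (compact_segment b b2) _).1.
  by exists (pt 2 b 0); split; rewrite ptE ?normr0.
have hc := compact_hull_wave.
have [hw _] := proj_nearest u2 hc (ex_intro _ k hk).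
have obt := proj_obtuse u2 k hc (hull_convex _) hk.
have wz1 := hull_wave_height _ hw; have wdisc := hull_wave_disc _ _ _ hw k1.
move: (proj (hull wave) u2) hw obt wz1 wdisc => w hw obt wz1 wdisc.
have [w1x w1y w1z] : segment (-1) (proj (segment (-1)) u3).
  by apply: sub; rewrite normrN normr1; lra.
have [w2x w2y w2z] : segment 1 (proj (segment 1) u1) by apply: sub; rewrite normr1; lra.
move=> [E1 E2 E3].
(* Going once around the cycle leaves the factor [1 - l ^+ 3 = eps * D] on [u2]. *)
have lin i : D * u2 ord0 i = l ^+ 2 * w ord0 i +
    l * proj (segment (-1)) u3 ord0 i + proj (segment 1) u1 ord0 i.
  apply: (mulfI (lt0r_neq0 e0)); rewrite -[eps in LHS](subKr 1) -/l.
  have -> : (1 - l) * (D * u2 ord0 i) = u2 ord0 i - l ^+ 3 * u2 ord0 i by rewrite /D; ring.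
  by rewrite {1}E2 E1 E3 !mxE; ring.
have l0 : 0 <= l by rewrite /l; lra.
(* The weights [l ^+ 2], [l] and 1 add up to [D], so this height is an average of three heights in
   [-1, 1]. *)
have u2z : `|cz u2| <= 1.
  have := lin (lift ord0 (lift ord0 ord0)).
  move: wz1 w1z w2z; rewrite !ler_norml /D => /andP[? ?] /andP[? ?] /andP[? ?] ?.
  by apply/andP; split; rewrite -(ler_pM2l D0) /D; nra.
have u3z : `|cz u3| <= 1.
  have -> : cz u3 = l * cz u2 + eps * cz w by rewrite E3 !mxE.
  by move: wz1 u2z; rewrite !ler_norml /l => /andP[? ?] /andP[? ?]; apply/andP; split; nra.
have W1 := proj_segment (-1) u3 u3z; rewrite W1 in E1 lin.
have u13 : cz u1 = cz u3 by rewrite E1 !mxE /= /l; ring.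
have W2 := proj_segment 1 u1; rewrite u13 in W2; move: (W2 u3z) => {}W2; rewrite W2 in E2 lin.
have u23 : cz u2 = cz u3 by rewrite E2 [LHS]mxE [X in X + _]mxE u13 !mxE /= /l; ring.
have uw : cz u2 = cz w.
  have : cz u3 = l * cz u2 + eps * cz w by rewrite E3 !mxE.
  rewrite -u23 /l => h; apply: (mulfI (lt0r_neq0 e0)); lra.
have linx := lin ord0; have liny := lin (lift ord0 ord0); rewrite !ptE in linx liny.
(* Horizontally [D (u2 - w) = (1 + l) (m - w)], so obtuseness at [w] against [k]
   reads [(N - 1) (1 - <k, w>) + |k - w|^2 <= 0]. *)
have wk : w = k.
  have ux : D * (cx u2 - cx w) = (1 + l) * (2 - cx w) by rewrite mulrBr linx /D; ring.
  have uy : D * (cy u2 - cy w) = (1 + l) * (N * cy k - cy w).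
    by rewrite mulrBr liny mulrBr [(1 + l) * (N * _)]mulrC Ny' /D; ring.
  have obt2 : (2 - cx w) * (cx k - cx w) + (N * cy k - cy w) * (cy k - cy w) <= 0.
    rewrite -(pmulr_rle0 _ (_ : 0 < 1 + l)); last by lra.
    rewrite mulrDr !mulrA -ux -uy -!mulrA -mulrDr pmulr_rle0 //.
    by move: obt; rewrite /dot !mxE uw subrr mul0r addr0.
  have sq : (cx k - cx w) ^+ 2 + (cy k - cy w) ^+ 2 <= 0.
    have : 0 <= (N - 1) * (1 - (cx k * cx w + cy k * cy w)).
      by apply: mulr_ge0; lra.
    move: obt2; rewrite -Nx => obt2 h.
    have := k1; nra.
  have sx := sqr_ge0 (cx k - cx w); have sy := sqr_ge0 (cy k - cy w).
  apply: hull_wave_fiber hw ak _ _;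
    by apply/eqP; rewrite eq_sym -subr_eq0 -sqrf_eq0; apply/eqP; lra.
subst w.
have e2 : u2 = pt ((l ^+ 2 * cx k + 2 * l + 2) / D) ((l ^+ 2 * cy k - l + 1) / D) (cz k).
  apply: R3P; rewrite !ptE.
  - by apply: (mulfI (lt0r_neq0 D0)); rewrite linx; field; exact: lt0r_neq0.
  - by apply: (mulfI (lt0r_neq0 D0)); rewrite liny; field; exact: lt0r_neq0.
  - by [].
rewrite /explicit_cycle -/l -/D -e2 -E3.
by congr (_, _, _); rewrite E1 -u23 uw.
Qed.

(** * Oscillation of the height *)

Lemma exists_eps_cycle (eps : R) : 0 < eps -> eps <= 1 ->
  exists v : R3 * R3 * R3,
    (forall u, eps_cycle eps (segment (-1)) (segment 1) (hull wave) u <-> u = v) /\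
    cz v.1.2 = sin (4 / eps - 2).
Proof.
move=> e0 e1; pose s := eps / (2 - eps).
have s0 : 0 < s by rewrite divr_gt0 //; lra.
pose N := Num.sqrt (4 + s ^+ 2).
have N2 : N ^+ 2 = 4 + s ^+ 2 by rewrite sqr_sqrtr //; nra.
have N0 : 0 <= N := sqrtr_ge0 _.
have N1 : 1 < N by nra.
have Nn : N != 0 by apply/eqP; lra.
(* The point of the curve over [m / |m|], where [N = |m|]; its slope ratio is
   [2 / s = 4 / eps - 2]. *)
pose k := pt (2 / N) (s / N) (sin (4 / eps - 2)).
have ak : wave k.
  split; rewrite !ptE.
  - have -> : (2 / N) ^+ 2 + (s / N) ^+ 2 = (4 + s ^+ 2) / N ^+ 2 by field.
    by rewrite -N2 divff // expf_neq0.
  - by rewrite divr_gt0 //; lra.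
  - congr sin; rewrite /s; field; rewrite Nn /=; lra.
exists (explicit_cycle eps k); split=> [u|]; last by rewrite /explicit_cycle /= !ptE.
by apply: (eps_cycleP eps N) => //; rewrite !ptE mulrC divfK.
Qed.

Lemma norm_sin_peak (K : realType) (n : nat) : `|sin (pi / 2 + n%:R * pi : K)| = 1.
Proof.
elim: n => [|n IH]; first by rewrite mul0r addr0 sin_pihalf normr1.
by rewrite -[n.+1%:R]natr1 [(n%:R + 1) * _]mulrDl mul1r addrA sinDpi normrN.
Qed.

Theorem theorem1 :
  exists C1 C2 C3 : set R3,
    [/\ C1 !=set0, C2 !=set0 & C3 !=set0] /\
    [/\ compact C1, compact C2 & compact C3] /\
    [/\ convex3 C1, convex3 C2 & convex3 C3] /\
    (forall eps : Rdefinitions.R, 0 < eps -> eps <= 1 ->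
       exists! u : R3 * R3 * R3, eps_cycle eps C1 C2 C3 u) /\
    (forall u : Rdefinitions.R -> R3 * R3 * R3,
       (forall eps : Rdefinitions.R, 0 < eps -> eps <= 1 ->
          eps_cycle eps C1 C2 C3 (u eps)) ->
       ~ (exists L : R3 * R3 * R3, u eps @[eps --> 0^'+] --> L)).
Proof.
exists (segment (-1)), (segment 1), (hull wave); split.
  split.
  - by exists (pt 2 (-1) 0); split; rewrite ptE ?normr0.
  - by exists (pt 2 1 0); split; rewrite ptE ?normr0.
  - exists (pt 0 1 0); apply: sub_hull; split; rewrite !ptE ?mul0r ?sin0 //.
    by rewrite expr0n expr1n add0r.
split.
  split; [apply: compact_segment|apply: compact_segment|exact: compact_hull_wave].
    by rewrite normrN normr1; lra.
  by rewrite normr1; lra.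
split.
  by rewrite -(hull_segment (-1)) -(hull_segment 1); split; exact: hull_convex.
split=> [eps e0 e1|u cu [L uL]].
  have [v [vP _]] := exists_eps_cycle eps e0 e1.
  by exists v; split=> [|w /vP ->//]; exact/vP.
have height eps : 0 < eps -> eps <= 1 -> cz (u eps).1.2 = sin (4 / eps - 2).
  move=> e0 e1; have [v [vP <-]] := exists_eps_cycle eps e0 e1.
  by rewrite ((vP _).1 (cu _ e0 e1)).
have /nbhs_ballP[r /= r0 rL] := uL _ (nbhsx_ballx L 1 ltr01).
have near_L eps : 0 < eps -> eps < r -> `|cz L.1.2 - cz (u eps).1.2| < 1.
  move=> e0 er.
  have : ball L 1 (u eps).
    apply: rL => //; apply: (_ : `|0 - eps| < r).
    by rewrite sub0r normrN gtr0_norm.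
  case=> -[_ [_ h]] _; exact: h ord0 (lift ord0 (lift ord0 ord0)).
pose n := Num.bound (4 / r).
have pi0 : 0 < pi :> R := pi_gt0 R.
have pi2 : 2 <= pi :> R := pi_ge2 R.
have n_gt : 4 / r < n%:R.
  by have := archi_boundP (_ : 0 <= 4 / r); rewrite -/n; apply; rewrite divr_ge0 // ltW.
have peak m : (n <= m)%N -> `|cz L.1.2 - sin (pi / 2 + m%:R * pi)| < 1.
  move=> nm; have mn : n%:R <= m%:R :> R by rewrite ler_nat.
  (* Chosen so that [eps = 4 / Y] gives [4 / eps - 2 = pi / 2 + m * pi], a peak of the sine. *)
  pose Y : R := 2 + (pi / 2 + m%:R * pi).
  have mpi : m%:R <= m%:R * pi :> R by rewrite ler_peMr //; lra.
  have Y4 : 4 / r < Y by rewrite /Y; lra.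
  have Y0 : 0 < Y by apply: le_lt_trans Y4; rewrite divr_ge0 // ltW.
  have m1 : 1 <= m%:R :> R.
    have : 0 < n%:R :> R by apply: lt_trans n_gt; rewrite divr_gt0.
    by rewrite ltr0n => n0; rewrite ler1n (leq_trans n0).
  have Y1 : 4 / Y <= 1 by rewrite ler_pdivrMr // mul1r /Y; lra.
  have e0 : 0 < 4 / Y by rewrite divr_gt0.
  have er : 4 / Y < r by rewrite ltr_pdivrMr // mulrC -ltr_pdivrMr.
  have YE : 4 / (4 / Y) = Y by field; rewrite lt0r_neq0.
  have -> : pi / 2 + m%:R * pi = 4 / (4 / Y) - 2 by rewrite YE /Y; ring.
  by rewrite -height //; exact: near_L.
(* Consecutive peaks are 1 and -1 in some order, and no number is at distance less than 1 from
   both. *)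
have := peak _ (leqnSn n); have := peak _ (leqnn n); have := norm_sin_peak R n.
rewrite -[n.+1%:R]natr1 [(n%:R + 1) * _]mulrDl mul1r addrA sinDpi.
move: (sin _) (cz _) => a b.
rewrite !ltr_norml; case: (lerP 0 a) => a0; [rewrite ger0_norm|rewrite ltr0_norm] => //; lra.
Qed.
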